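(* Let $2^{t-1}<n\le 2^t-4$, $i=2^t-3-n$, $j=n-2^{t-1}+1$. Define $D_n=q_ip_n+q_{i+1}p_{n-1}+w_3q_{i-1}p_{n-2}$ and $A_n=r_{j-1}p_n+w_3r_{j-2}p_{n-1}+r_jp_{n-2}$ in $W_1$, and denote also by $A_n,D_n$ their images in ${\rm H}^*(\operatorname{Gr}_3(n);\mathbb{F}_2)$. Then $A_n,D_n$ lie in $K$, are homogeneous of degrees $\deg A_n=3n-2^t-1$ and $\deg D_n=2^t-4$, and the map sending the free generators $A,D$ to $A_n,D_n$ induces an isomorphism of graded $C$-modules \[ K\cong C\langle A,D\rangle\big/\big(q_iA+r_{j-1}D,\ q_{i+1}A+w_3r_{j-2}D,\ w_3q_{i-1}A+r_jD\big), \] the three relations having degrees $2n-4$, $2n-3$, $2n-2$.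
   Context: $W_1=\mathbb{F}_2[w_1,w_2,w_3]$ and $W_2=\mathbb{F}_2[w_2,w_3]$, graded by $\deg w_i=i$. $Q_m\in W_1$: $Q_0=1$, $Q_m=0$ for $m<0$, $Q_m=w_1Q_{m-1}+w_2Q_{m-2}+w_3Q_{m-3}$ for $m\ge1$; ${\rm H}^*(\operatorname{Gr}_3(n);\mathbb{F}_2)=W_1/(Q_{n-2},Q_{n-1},Q_n)$ with $w_i$ the Stiefel–Whitney classes of the tautological bundle. $q_m=Q_m|_{w_1=0}\in W_2$ (so $q_0=1$, $q_{m<0}=0$, $q_m=w_2q_{m-2}+w_3q_{m-3}$ for $m\ge1$); $r_0=1$, $r_{m<0}=0$, $r_{m+1}=w_2r_m+w_3^2r_{m-2}$. Viewing $q_m\in W_1$, $Q_m-q_m$ is divisible by $w_1$ and $p_m:=(Q_m-q_m)/w_1\in W_1$ (homogeneous of degree $m-1$). $C={\rm H}^*(\operatorname{Gr}_3(n);\mathbb{F}_2)/(w_1)=W_2/(q_{n-2},q_{n-1},q_n)$ and $K=\ker(w_1\cdot)$ on ${\rm H}^*(\operatorname{Gr}_3(n);\mathbb{F}_2)$, a $C$-module. *)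

(* Defs.v *)
From HB Require Import structures.
From mathcomp Require Import all_boot all_order all_algebra.
From mathcomp Require Import mpoly ring.
From Stdlib Require Import ClassicalEpsilon.
Set Implicit Arguments. Unset Strict Implicit. Unset Printing Implicit Defensive.
Import Order.TTheory GRing.Theory.
Local Open Scope ring_scope.

Notation W1 := {mpoly 'F_2[3]}.
(* W_2 = F_2[w2,w3]: 'X_0 = w2, 'X_1 = w3. *)
Notation W2 := {mpoly 'F_2[2]}.

Definition w1 : W1 := 'X_(@Ordinal 3 0 isT).
Definition w2 : W1 := 'X_(@Ordinal 3 1 isT).
Definition w3 : W1 := 'X_(@Ordinal 3 2 isT).
Definition v2 : W2 := 'X_(@Ordinal 2 0 isT).
Definition v3 : W2 := 'X_(@Ordinal 2 1 isT).

Definition incl (p : W2) : W1 := comp_mpoly [tuple w2; w3] p.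

(* Weighted grading with deg w_i = i.
   On W_1 this is the library weight mnmwgt (variable k has weight k+1). *)
Definition homog1 (d : nat) (p : W1) : bool := p \is ishomog1 d mnmwgt.
Definition wgt2 (m : 'X_{1..2}) : nat :=
  (2 * m (@Ordinal 2 0 isT) + 3 * m (@Ordinal 2 1 isT))%N.
Definition homog2 (d : nat) (p : W2) : bool :=
  all (fun m => wgt2 m == d) (msupp p).

(* Linear recurrence x_0 = 1, x_{<0} = 0, x_m = a x_{m-1} + b x_{m-2} + c x_{m-3}.
   rec3 returns the triple (x_m, x_{m-1}, x_{m-2}). *)
Fixpoint rec3 (R : ringType) (a b c : R) (m : nat) : R * R * R :=
  match m with
  | 0 => (1, 0, 0)
  | m'.+1 => let: (x, y, z) := rec3 a b c m' in (a * x + b * y + c * z, x, y)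
  end.
Definition seq3 (R : ringType) (a b c : R) (m : nat) : R := (rec3 a b c m).1.1.

Definition Q (m : nat) : W1 := seq3 w1 w2 w3 m.
Definition q (m : nat) : W2 := seq3 0 v2 v3 m.
Definition r (m : nat) : W2 := seq3 v2 0 (v3 ^+ 2) m.

(* p_m := (Q_m - q_m) / w1 in W_1 (well-defined since w1 is regular in the
   domain W_1 and divides Q_m - q_m). *)
Definition p_spec (m : nat) (x : W1) : Prop := w1 * x = Q m - incl (q m).
Definition p (m : nat) : W1 :=
  epsilon (inhabits 0) (p_spec m).

Lemma rec3_map (R S : ringType) (f : {rmorphism R -> S}) (a b c : R) m :
  let t := rec3 a b c m in
  rec3 (f a) (f b) (f c) m = (f t.1.1, f t.1.2, f t.2).
Proof.
elim: m => [|m IH] /=; first by rewrite rmorph1 !rmorph0.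
move: IH; case: (rec3 a b c m) => [[x y] z] /= ->.
by rewrite !rmorphD !rmorphM.
Qed.

Lemma incl_q m : incl (q m) = seq3 0 w2 w3 m.
Proof.
have h := @rec3_map _ _ (comp_mpoly [tuple w2; w3]) 0 v2 v3 m.
rewrite rmorph0 /= in h.
have e2 : comp_mpoly [tuple w2; w3] v2 = w2 by rewrite /v2 comp_mpolyXU.
have e3 : comp_mpoly [tuple w2; w3] v3 = w3 by rewrite /v3 comp_mpolyXU.
rewrite e2 e3 in h.
by rewrite /seq3 h.
Qed.

Fixpoint prec (m : nat) : W1 * W1 * W1 :=
  match m with
  | 0 => (0, 0, 0)
  | m'.+1 => let: (x, y, z) := prec m' in (Q m' + w2 * y + w3 * z, x, y)
  end.

Lemma p_exists m : exists x, p_spec m x.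
Proof.
rewrite /p_spec incl_q /Q /seq3.
suff H : forall m, let t := prec m in let u := rec3 w1 w2 w3 m in
                   let v := rec3 0 w2 w3 m in
  [/\ w1 * t.1.1 = u.1.1 - v.1.1, w1 * t.1.2 = u.1.2 - v.1.2 &
      w1 * t.2 = u.2 - v.2].
  by exists (prec m).1.1; case: (H m).
elim=> [|k IH] /=; first by rewrite !mulr0 !subrr.
move: IH; rewrite /Q /seq3.
case: (prec k) => [[x y] z]; case: (rec3 w1 w2 w3 k) => [[a b] c];
case: (rec3 0 w2 w3 k) => [[d e] f] /= [h1 h2 h3]; split => //.
rewrite mulrDr mulrDr mulrCA h2 mulrCA h3; ring.
Qed.

Lemma p_specP m : p_spec m (p m).
Proof. exact: (epsilon_spec (inhabits 0) (p_spec m) (p_exists m)). Qed.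

Definition in_ideal3 (R : comRingType) (g1 g2 g3 f : R) : Prop :=
  exists c1 c2 c3 : R, f = c1 * g1 + c2 * g2 + c3 * g3.

(* The ideal defining H^*(Gr_3(n)) in W_1, and the ideal defining C in W_2. *)
Definition inI (n : nat) (f : W1) : Prop := in_ideal3 (Q (n - 2)) (Q (n - 1)) (Q n) f.
Definition inJ (n : nat) (f : W2) : Prop := in_ideal3 (q (n - 2)) (q (n - 1)) (q n) f.

(* Grading of the free graded C-module on A, D with deg A = dA, deg D = dD:
   (a, d) represents a*A + d*D, homogeneous of degree e. *)
Definition homogAD (dA dD e : nat) (a d : W2) : bool :=
  (if (dA <= e)%N then homog2 (e - dA) a else a == 0) &&
  (if (dD <= e)%N then homog2 (e - dD) d else d == 0).

Definition idx_i (t n : nat) : nat := (2 ^ t - 3 - n)%N.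
Definition idx_j (t n : nat) : nat := (n - 2 ^ t.-1 + 1)%N.
Definition An (t n : nat) : W1 :=
  let j := idx_j t n in
  incl (r (j - 1)) * p n + w3 * incl (r (j - 2)) * p (n - 1) + incl (r j) * p (n - 2).
Definition Dn (t n : nat) : W1 :=
  let i := idx_i t n in
  incl (q i) * p n + incl (q (i + 1)) * p (n - 1) + w3 * incl (q (i - 1)) * p (n - 2).

(* Main.v *)
Require Import Defs.
From HB Require Import structures.
From mathcomp Require Import all_boot all_order all_algebra.
From mathcomp Require Import mpoly ring zify.
Set Implicit Arguments. Unset Strict Implicit. Unset Printing Implicit Defensive.
Import GRing.Theory.
Local Open Scope ring_scope.

(** If w1 f = c . (Q_{n-2}, Q_{n-1}, Q_n), then reducing c modulo w1 gives a
    syzygy s of (q_{n-2}, q_{n-1}, q_n), and f = s . (p_{n-2}, p_{n-1}, p_n)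
    modulo I, because Q_m = q_m + w1 p_m. As (Q_{n-2}, Q_{n-1}, Q_n) has only
    Koszul syzygies, s . p lies in I exactly when s is itself a Koszul syzygy.
    So K is the module of syzygies of the q's modulo the Koszul ones.

    The vector of the q's is the cross product of
    a = (r_j, w3 r_{j-2}, r_{j-1}) and b = (w3 q_{i-1}, q_{i+1}, q_i), which
    follows by induction on j from q_{2^s - 3} = 0. By the Hilbert-Burch
    argument a and b freely generate the syzygies; they map to A_n and D_n.
    The relations come from the Koszul syzygies through
    e x (a x b) = (e . b) a - (e . a) b.

    Exactness of the Koszul complex of the Q's follows from that of
    (w1, w2, w3), since it passes to products of entries:
    Q_{m+3} = w3 Q_m modulo (Q_{m+1}, Q_{m+2}). *)

(** * Vectors of length 3 and the Koszul complex *)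

Section Vector3.
Context (R : comNzRingType).
Implicit Types u v : R * R * R.

Definition dot u v : R :=
  u.1.1 * v.1.1 + u.1.2 * v.1.2 + u.2 * v.2.

Definition cross u v : R * R * R :=
  (u.1.2 * v.2 - u.2 * v.1.2, u.2 * v.1.1 - u.1.1 * v.2,
   u.1.1 * v.1.2 - u.1.2 * v.1.1).

(* Vanishing of the first Koszul homology of the three entries of v. *)
Definition koszul_exact v := forall u, dot u v = 0 -> exists e, u = cross e v.

Lemma koszul_exact_rot a b c :
  koszul_exact (a, b, c) -> koszul_exact (b, c, a).
Proof.
move=> kK [[x y] z]; rewrite /dot /= => E.
have [|[[e1 e2] e3] []] := kK (z, x, y); first by rewrite /dot /= -E; ring.
by move=> -> -> ->; exists (e2, e3, e1).
Qed.

Lemma koszul_exact_swap a b c :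
  koszul_exact (a, b, c) -> koszul_exact (b, a, c).
Proof.
move=> kK [[x y] z]; rewrite /dot /= => E.
have [|[[e1 e2] e3] []] := kK (y, x, z); first by rewrite /dot /= -E; ring.
move=> -> -> ->; exists (- e2, - e1, - e3); rewrite /cross /=.
by congr (_, _, _); ring.
Qed.

Lemma koszul_exact1 b c : koszul_exact (1, b, c).
Proof.
move=> [[x y] z]; rewrite /dot /= mulr1 => E.
have -> : x = - (y * b) - z * c by rewrite -[LHS]subr0 -E; ring.
by exists (0, - z, y); rewrite /cross /=; congr (_, _, _); ring.
Qed.

(** An elementary change of generators: the transposed change turns [u] into a syzygy of the old
    triple, and the change of the Koszul witness touches only its last entry. *)
Lemma koszul_exact_add a b c k l :
  koszul_exact (a, b, c) -> koszul_exact (a, b, c + k * a + l * b).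
Proof.
move=> kK [[x y] z]; rewrite /dot /= => E.
have [|[[e1 e2] e3] []] := kK (x + z * k, y + z * l, z).
  by rewrite /dot /= -E; ring.
move=> /= Ex Ey Ez; exists (e1, e2, e3 + k * e1 + l * e2).
rewrite /cross /=; congr (_, _, _) => //.
  by rewrite -[x](addrK (z * k)) Ex Ez; ring.
by rewrite -[y](addrK (z * l)) Ey Ez; ring.
Qed.

(** Moving [d] onto the last coefficient gives a syzygy of [(a, b, c)], hence
    [z * d = e1 * b - e2 * a]. This is again a syzygy, now of [(a, b, d)], to which the second
    hypothesis applies. *)
Lemma koszul_exact_mul a b c d :
  koszul_exact (a, b, c) -> koszul_exact (a, b, d) ->
  koszul_exact (a, b, c * d).
Proof.
move=> kc kd [[x y] z]; rewrite /dot /= => E.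
have [|[[e1 e2] e3] [Ex Ey Ez]] := kc (x, y, z * d).
  by rewrite /dot /= -E; ring.
have [|[[f1 f2] f3] [E2 E1 ->]] := kd (e2, - e1, z).
  by rewrite /dot /= Ez /=; ring.
exists (f1, f2, e3 + f3 * c); rewrite /cross /=; congr (_, _, _).
  by rewrite Ex /= E2 /=; ring.
by rewrite Ey /= -[e1]opprK E1 /=; ring.
Qed.

End Vector3.

(** * The Hilbert-Burch argument *)

Section HilbertBurch.
Context (R : idomainType).
Implicit Types a b c s u q : R * R * R.

Definition scale3 (x : R) u : R * R * R := (x * u.1.1, x * u.1.2, x * u.2).

(** [dot c (cross a b)] is the determinant of [c, a, b]; its product with [v.1.1] expands into
    entries of [cross v a] and [cross v b]. Cyclic rotation yields the other two entries. *)
Lemma cross_eq0_both_fst a b v c : cross v a = 0 -> cross v b = 0 ->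
  v.1.1 * dot c (cross a b) = 0.
Proof.
case: a b v c => [[a1 a2] a3] [[b1 b2] b3] [[v1 v2] v3] [[c1 c2] c3].
rewrite /cross /dot /= => -[Y1 Y2 Y3] [X1 X2 X3].
have -> : v1 * (c1 * (a2 * b3 - a3 * b2) + c2 * (a3 * b1 - a1 * b3) +
                c3 * (a1 * b2 - a2 * b1)) =
  c1 * ((v1 * a2 - v2 * a1) * b3 + (v3 * a1 - v1 * a3) * b2 +
        a1 * (v2 * b3 - v3 * b2)) +
  c2 * (a1 * (v3 * b1 - v1 * b3) - (v3 * a1 - v1 * a3) * b1) +
  c3 * (a1 * (v1 * b2 - v2 * b1) - (v1 * a2 - v2 * a1) * b1) by ring.
by rewrite Y2 Y3 X1 X2 X3; ring.
Qed.

Lemma cross_eq0_both a b v c : cross v a = 0 -> cross v b = 0 ->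
  dot c (cross a b) != 0 -> v = 0.
Proof.
case: a b v c => [[a1 a2] a3] [[b1 b2] b3] [[v1 v2] v3] [[c1 c2] c3].
move=> va vb cq.
have v0 x : x * dot (c1, c2, c3) (cross (a1, a2, a3) (b1, b2, b3)) = 0 -> x = 0.
  by move/eqP; rewrite mulf_eq0 (negPf cq) orbF => /eqP.
have {1}-> : v1 = 0 by apply/v0; exact: (cross_eq0_both_fst _ va vb).
case: va vb => Y1 Y2 Y3 [X1 X2 X3].
have -> : v2 = 0.
  apply/v0; rewrite -(@cross_eq0_both_fst (a2, a3, a1) (b2, b3, b1)
    (v2, v3, v1) (c2, c3, c1)) /dot /cross /= ?Y1 ?Y2 ?Y3 ?X1 ?X2 ?X3 //=.
  by ring.
have -> : v3 = 0.
  apply/v0; rewrite -(@cross_eq0_both_fst (a3, a1, a2) (b3, b1, b2)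
    (v3, v1, v2) (c3, c1, c2)) /dot /cross /= ?Y1 ?Y2 ?Y3 ?X1 ?X2 ?X3 //=.
  by ring.
by [].
Qed.

(** With q = a x b and s.q = 0, both s x b and s x a are parallel to q, hence multiples x q and y q
    by the depth hypothesis. Then s - x a + y b has zero cross product with both [a] and [b], so it
    vanishes. *)
Lemma hilbert_burch a b c s :
  (forall u, cross u (cross a b) = 0 -> exists x, u = scale3 x (cross a b)) ->
  dot c (cross a b) != 0 -> dot s (cross a b) = 0 ->
  exists x y, s = scale3 x a + scale3 y b.
Proof.
move=> H2 cq sq.
have [x Ex] : exists x, cross s b = scale3 x (cross a b).
  apply: H2; move: sq; case: a b s {cq} => [[a1 a2] a3] [[b1 b2] b3] [[s1 s2] s3].
  rewrite /dot /cross /= => sq.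
  by congr (_, _, _); [rewrite -[RHS](mulr0 b1)|rewrite -[RHS](mulr0 b2)|
    rewrite -[RHS](mulr0 b3)]; rewrite -sq; ring.
have [y Ey] : exists x, cross s a = scale3 x (cross a b).
  apply: H2; move: sq; case: a b s {cq x Ex} => [[a1 a2] a3] [[b1 b2] b3] [[s1 s2] s3].
  rewrite /dot /cross /= => sq.
  by congr (_, _, _); [rewrite -[RHS](mulr0 a1)|rewrite -[RHS](mulr0 a2)|
    rewrite -[RHS](mulr0 a3)]; rewrite -sq; ring.
exists x, (- y); apply/eqP; rewrite -subr_eq0; apply/eqP.
apply: (@cross_eq0_both a b _ c) => //.
  move: Ey; case: a b s {H2 cq sq Ex} => [[a1 a2] a3] [[b1 b2] b3] [[s1 s2] s3].
  rewrite /scale3 /cross /= => -[E1 E2 E3].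
  congr (_, _, _); rewrite /=.
  - by transitivity (s2 * a3 - s3 * a2 - y * (a2 * b3 - a3 * b2)); [ring|
    rewrite E1 subrr].
  - by transitivity (s3 * a1 - s1 * a3 - y * (a3 * b1 - a1 * b3)); [ring|
    rewrite E2 subrr].
  - by transitivity (s1 * a2 - s2 * a1 - y * (a1 * b2 - a2 * b1)); [ring|
    rewrite E3 subrr].
move: Ex; case: a b s {H2 cq sq Ey} => [[a1 a2] a3] [[b1 b2] b3] [[s1 s2] s3].
rewrite /scale3 /cross /= => -[E1 E2 E3].
congr (_, _, _); rewrite /=.
- by transitivity (s2 * b3 - s3 * b2 - x * (a2 * b3 - a3 * b2)); [ring|
    rewrite E1 subrr].
- by transitivity (s3 * b1 - s1 * b3 - x * (a3 * b1 - a1 * b3)); [ring|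
    rewrite E2 subrr].
- by transitivity (s1 * b2 - s2 * b1 - x * (a1 * b2 - a2 * b1)); [ring|
    rewrite E3 subrr].
Qed.

Lemma scale3_eq0 x u c : dot c u != 0 -> scale3 x u = 0 -> x = 0.
Proof.
case: u c => [[u1 u2] u3] [[c1 c2] c3] cu [E1 E2 E3]; apply/eqP.
move: cu; apply: contraNT => xN0; apply/eqP/(mulfI xN0).
transitivity (c1 * (x * u1) + c2 * (x * u2) + c3 * (x * u3)).
  by rewrite /dot /=; ring.
by rewrite E1 E2 E3; ring.
Qed.

(** The cross product of the relation with [b] leaves a multiple of [x], the one with [a] a multiple
    of [y]. *)
Lemma cross_free a b c x y : dot c (cross a b) != 0 ->
  scale3 x a + scale3 y b = 0 -> x = 0 /\ y = 0.
Proof.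
move=> cq E; split; apply: (scale3_eq0 cq); move: E {cq};
  case: a b => [[a1 a2] a3] [[b1 b2] b3];
  rewrite /scale3 /cross /= => -[/= E1 E2 E3]; congr (_, _, _) => /=.
- transitivity ((x * a2 + y * b2) * b3 - (x * a3 + y * b3) * b2); first by ring.
  by rewrite E2 E3; ring.
- transitivity ((x * a3 + y * b3) * b1 - (x * a1 + y * b1) * b3); first by ring.
  by rewrite E1 E3; ring.
- transitivity ((x * a1 + y * b1) * b2 - (x * a2 + y * b2) * b1); first by ring.
  by rewrite E1 E2; ring.
- transitivity ((x * a3 + y * b3) * a2 - (x * a2 + y * b2) * a3); first by ring.
  by rewrite E2 E3; ring.
- transitivity ((x * a1 + y * b1) * a3 - (x * a3 + y * b3) * a1); first by ring.
  by rewrite E1 E3; ring.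
- transitivity ((x * a2 + y * b2) * a1 - (x * a1 + y * b1) * a2); first by ring.
  by rewrite E1 E2; ring.
Qed.

(* An ideal of depth at least 2, witnessed by a power of z lying in it and by
   z not dividing both q1 and q2. *)
Lemma parallel_multiple (z : R) N c q : z != 0 -> dot c q = z ^+ N ->
  (forall x, (exists y, x * q.1.1 = z * y) -> (exists y, x * q.1.2 = z * y) ->
     exists y, x = z * y) ->
  forall u, cross u q = 0 -> exists x, u = scale3 x q.
Proof.
case: q c => [[q1 q2] q3] [[c1 c2] c3] z0.
rewrite {1}/dot /= => cq prim [[u1 u2] u3] [E1 E2 E3].
have {}E1 : u2 * q3 = u3 * q2 by apply/eqP; rewrite -subr_eq0; apply/eqP.
have {}E2 : u3 * q1 = u1 * q3 by apply/eqP; rewrite -subr_eq0; apply/eqP.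
have {}E3 : u1 * q2 = u2 * q1 by apply/eqP; rewrite -subr_eq0; apply/eqP.
(* Since [u] is parallel to [q], pairing with [c] gives [k] times q equal to [z ^+ N] times u; the
   quotient of [k] by [z ^+ N] is the required factor. *)
pose k := c1 * u1 + c2 * u2 + c3 * u3.
have k1 : k * q1 = z ^+ N * u1.
  rewrite -cq; transitivity (c1 * u1 * q1 + c2 * (u2 * q1) + c3 * (u3 * q1)).
    by rewrite /k; ring.
  by rewrite -E3 E2; ring.
have k2 : k * q2 = z ^+ N * u2.
  rewrite -cq; transitivity (c1 * (u1 * q2) + c2 * u2 * q2 + c3 * (u3 * q2)).
    by rewrite /k; ring.
  by rewrite -E1 E3; ring.
have k3 : k * q3 = z ^+ N * u3.
  rewrite -cq; transitivity (c1 * (u1 * q3) + c2 * (u2 * q3) + c3 * u3 * q3).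
    by rewrite /k; ring.
  by rewrite E1 -E2; ring.
(* Powers of [z] are stripped off one at a time: [z] divides [k * q1] and [k * q2], hence [k]. *)
have [x kx] : exists x, k = z ^+ N * x.
  elim: N {cq k3} k k1 k2 => [|N IH] k; first by exists k; rewrite expr0 mul1r.
  rewrite exprS -!mulrA => k1 k2.
  have [y Ey] := prim k (ex_intro _ _ k1) (ex_intro _ _ k2).
  have [||x Ex] := IH y.
  - by apply: (mulfI z0); rewrite mulrA -Ey k1.
  - by apply: (mulfI z0); rewrite mulrA -Ey k2.
  - by exists x; rewrite Ey Ex mulrA.
have zN : z ^+ N != 0 by rewrite expf_neq0.
exists x; rewrite /scale3 /=.
by congr (_, _, _); apply: (mulfI zN); rewrite mulrA -kx.
Qed.

End HilbertBurch.

(** * Annihilator of w in a complete intersection *)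

Definition map3 (R S : Type) (f : R -> S) (u : R * R * R) : S * S * S :=
  (f u.1.1, f u.1.2, f u.2).

Section RegularQuotient.
Context (S R : idomainType).
Context (iota : {rmorphism S -> R}) (pi : {rmorphism R -> S}) (w : R).
Hypothesis iotaK : cancel iota pi.
Hypothesis w_neq0 : w != 0.
Hypothesis pi_w : pi w = 0.
Hypothesis pi_split : forall f, exists g, f = iota (pi f) + w * g.
Context (Q P : R * R * R) (q : S * S * S).
Hypothesis QE : Q = map3 iota q + scale3 w P.

Lemma pi_Q : map3 pi Q = q.
Proof.
rewrite QE; case: q P => [[q1 q2] q3] [[P1 P2] P3]; rewrite /map3 /=.
by rewrite !rmorphD !rmorphM pi_w !mul0r !addr0 !iotaK.
Qed.

Lemma iota_dot s : iota (dot s q) =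
  dot (map3 iota s) Q - w * dot (map3 iota s) P.
Proof.
rewrite QE; case: q P s => [[q1 q2] q3] [[P1 P2] P3] [[s1 s2] s3].
by rewrite /dot /map3 /scale3 /= !rmorphD !rmorphM /=; ring.
Qed.

Lemma pi_dot c : pi (dot c Q) = dot (map3 pi c) q.
Proof. by rewrite -pi_Q /dot /map3 /= !rmorphD !rmorphM. Qed.

Lemma syzygy_annihilated s : dot s q = 0 ->
  w * dot (map3 iota s) P = dot (map3 iota s) Q.
Proof.
move=> sq; apply/esym/eqP; rewrite -subr_eq0 -iota_dot sq.
by rewrite rmorph0.
Qed.

Lemma lift3 c : exists g, c = map3 iota (map3 pi c) + scale3 w g.
Proof.
case: c => [[c1 c2] c3].
have [g1 E1] := pi_split c1; have [g2 E2] := pi_split c2.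
have [g3 E3] := pi_split c3; exists (g1, g2, g3).
by rewrite {1}E1 {1}E2 {1}E3.
Qed.

(** Writing [c] as s + w g turns c.Q into w (s.P + g.Q), and [w] cancels. *)
Lemma annihilated_syzygy f c : w * f = dot c Q ->
  exists s g, dot s q = 0 /\ f - dot (map3 iota s) P = dot g Q.
Proof.
move=> fc; have [g cE] := lift3 c; exists (map3 pi c), g.
have sq : dot (map3 pi c) q = 0 by rewrite -pi_dot -fc rmorphM pi_w mul0r.
split=> //; apply: (mulfI w_neq0).
rewrite mulrBr syzygy_annihilated // fc {1}cE.
move: (map3 iota _) => s; case: Q s g {cE} => [[Q1 Q2] Q3] [[s1 s2] s3] [[g1 g2] g3].
by rewrite /dot /scale3 /=; ring.
Qed.

(** As s.Q = w (s.P) = w (c.Q), the vector s - w c is a syzygy of [Q], hence Koszul; [pi] then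
    removes the term w c. *)
Lemma syzygy_image_in_ideal s c : koszul_exact Q -> dot s q = 0 ->
  dot (map3 iota s) P = dot c Q -> exists e, s = cross e q.
Proof.
move=> kQ /syzygy_annihilated sQ sc.
have [|e Ee] := kQ (map3 iota s - scale3 w c).
  transitivity (dot (map3 iota s) Q - w * dot c Q); last by rewrite -sQ sc subrr.
  case: Q s c {sc sQ kQ} => [[Q1 Q2] Q3] [[s1 s2] s3] [[c1 c2] c3].
  by rewrite /dot /scale3 /=; ring.
exists (map3 pi e); have := congr1 (map3 pi) Ee; rewrite -pi_Q.
case: Q s c e {sc sQ kQ Ee} => [[Q1 Q2] Q3] [[s1 s2] s3] [[c1 c2] c3] [[e1 e2] e3].
rewrite /map3 /cross /scale3 /= !rmorphB !rmorphM pi_w !mul0r !iotaK !subr0.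
by [].
Qed.

(** Replacing q by Q - w P costs nothing because (e x P).P = 0; what remains is the antisymmetry of
    the triple product. *)
Lemma koszul_image_in_ideal e :
  dot (map3 iota (cross e q)) P = dot (- cross (map3 iota e) P) Q.
Proof.
rewrite QE; case: q P e => [[q1 q2] q3] [[P1 P2] P3] [[e1 e2] e3].
rewrite /dot /map3 /cross /scale3 /= !rmorphB !rmorphM /=; ring.
Qed.

(** This makes the annihilator of [w] a module over the quotient by the q's: k.q differs from k.Q by
    a multiple of [w], which kills [f]. *)
Lemma ideal_mul_annihilated k f c : w * f = dot c Q ->
  exists g, iota (dot k q) * f = dot g Q.
Proof.
move=> fc; exists (scale3 f (map3 iota k) - scale3 (dot (map3 iota k) P) c).
transitivity (dot (map3 iota k) Q * f - dot (map3 iota k) P * dot c Q).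
  by rewrite iota_dot -fc; ring.
move: (map3 iota k) (dot _ P) => s x.
case: Q s c {fc} => [[Q1 Q2] Q3] [[s1 s2] s3] [[c1 c2] c3].
by rewrite /dot /scale3 /=; ring.
Qed.

End RegularQuotient.

(** * Generators and relations of the annihilator of w *)

Section DotCross.
Context (R : comNzRingType).
Implicit Types a b e u v : R * R * R.

Lemma dotDl u v w : dot (u + v) w = dot u w + dot v w.
Proof. by rewrite /dot /=; ring. Qed.

Lemma dot0l (w : R * R * R) : dot 0 w = 0.
Proof. by rewrite /dot /=; ring. Qed.

Lemma dot_crossl a b : dot a (cross a b) = 0.
Proof. by rewrite /dot /cross /=; ring. Qed.

Lemma dot_crossr a b : dot b (cross a b) = 0.
Proof. by rewrite /dot /cross /=; ring. Qed.

End DotCross.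

Lemma dotZl (R : idomainType) x (u w : R * R * R) :
  dot (scale3 x u) w = x * dot u w.
Proof. by rewrite /dot /=; ring. Qed.

Lemma cross_cross (R : idomainType) (e a b : R * R * R) :
  cross e (cross a b) = scale3 (dot e b) a + scale3 (- dot e a) b.
Proof.
case: e a b => [[e1 e2] e3] [[a1 a2] a3] [[b1 b2] b3].
by rewrite /dot /cross /scale3 /=; congr (_, _, _) => /=; ring.
Qed.

Section Presentation.
Context (S R : idomainType).
Context (iota : {rmorphism S -> R}) (pi : {rmorphism R -> S}) (w : R).
Hypothesis iotaK : cancel iota pi.
Hypothesis w_neq0 : w != 0.
Hypothesis pi_w : pi w = 0.
Hypothesis pi_split : forall f, exists g, f = iota (pi f) + w * g.
Context (Q P : R * R * R) (a b c : S * S * S).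
Local Notation q := (cross a b).
Hypothesis QE : Q = map3 iota q + scale3 w P.
Hypothesis exactQ : koszul_exact Q.
Hypothesis c_neq0 : dot c q != 0.
Hypothesis depth_q :
  forall u, cross u q = 0 -> exists x, u = scale3 x q.
Local Notation A := (dot (map3 iota a) P).
Local Notation D := (dot (map3 iota b) P).

Lemma map3_comb_dot x y : dot (map3 iota (scale3 x a + scale3 y b)) P =
  iota x * A + iota y * D.
Proof. by rewrite /dot /map3 /scale3 /= !rmorphD !rmorphM /=; ring. Qed.

Lemma generators_annihilated :
  (exists k, w * A = dot k Q) /\ (exists k, w * D = dot k Q).
Proof.
split; [exists (map3 iota a)|exists (map3 iota b)];
  apply: (syzygy_annihilated QE); [exact: dot_crossl|exact: dot_crossr].
Qed.

Lemma annihilator_generated f : (exists k, w * f = dot k Q) ->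
  exists x y k, f - (iota x * A + iota y * D) = dot k Q.
Proof.
case=> k fk.
have [s [g [sq fg]]] := annihilated_syzygy iotaK w_neq0 pi_w pi_split QE fk.
have [x [y sE]] := hilbert_burch depth_q c_neq0 sq.
by exists x, y, g; rewrite -map3_comb_dot -sE.
Qed.

Lemma annihilator_relations x y :
  (exists k, iota x * A + iota y * D = dot k Q) <->
  exists e, (exists k, x - dot e b = dot k q) /\
            (exists k, y + dot e a = dot k q).
Proof.
split=> [[k]|[e [[k xk] [k' yk']]]].
  rewrite -map3_comb_dot => sk.
  have s0 : dot (scale3 x a + scale3 y b) q = 0.
    by rewrite dotDl !dotZl dot_crossl dot_crossr !mulr0 addr0.
  have [e] := syzygy_image_in_ideal iotaK pi_w QE exactQ s0 sk.
  (* x a + y b equals (e.b) a - (e.a) b, so freeness gives equality of coefficients in [S] itself,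
     and the ideal members are 0. *)
  rewrite cross_cross => E; exists e.
  have [] := @cross_free _ a b c (x - dot e b) (y + dot e a) c_neq0.
    transitivity (scale3 x a + scale3 y b -
      (scale3 (dot e b) a + scale3 (- dot e a) b)); last by rewrite E subrr.
    by rewrite /scale3; congr (_, _, _) => /=; ring.
  by move=> -> ->; split; exists 0; rewrite dot0l.
(* Conversely, ideal multiples of the generators vanish modulo [Q], which leaves the image of the
   Koszul syzygy of [e]. *)
have [[k1 E1] [k2 E2]] := generators_annihilated.
have [g1 G1] := ideal_mul_annihilated QE k E1.
have [g2 G2] := ideal_mul_annihilated QE k' E2.
have [g3 G3] : exists g, dot (map3 iota (cross e q)) P = dot g Q.
  by eexists; exact: (koszul_image_in_ideal QE).
exists (g3 + g1 + g2); rewrite !dotDl -G1 -G2 -G3 -xk -yk' cross_cross.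
by rewrite map3_comb_dot !(rmorphD, rmorphB, rmorphN) /=; ring.
Qed.

End Presentation.

Lemma in_ideal3P (R : comNzRingType) (g1 g2 g3 f : R) :
  in_ideal3 g1 g2 g3 f <-> exists c, f = dot c (g1, g2, g3).
Proof.
by split=> [[c1 [c2 [c3 ->]]]|[[[c1 c2] c3] ->]]; [exists (c1, c2, c3)|exists c1, c2, c3].
Qed.

Lemma addr3_rev (V : nmodType) (x y z : V) : x + y + z = z + y + x.
Proof. by rewrite addrC [x + y]addrC addrA. Qed.

(** Coordinate form of the presentation. Signs disappear since [- x = x], and sums run from index 3
    down to match the order p_n, p_{n-1}, p_{n-2} in [An] and [Dn]. *)
Lemma annihilator_presentation (S R : idomainType)
    (iota : {rmorphism S -> R}) (pi : {rmorphism R -> S}) (w : R)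
    (Q1 Q2 Q3 P1 P2 P3 : R) (q1 q2 q3 a1 a2 a3 b1 b2 b3 : S) (c : S * S * S) :
  cancel iota pi -> w != 0 -> pi w = 0 ->
  (forall f, exists g, f = iota (pi f) + w * g) ->
  (forall x : S, - x = x) ->
  [/\ Q1 = iota q1 + w * P1, Q2 = iota q2 + w * P2 & Q3 = iota q3 + w * P3] ->
  (q1, q2, q3) = cross (a1, a2, a3) (b1, b2, b3) ->
  koszul_exact (Q1, Q2, Q3) -> dot c (q1, q2, q3) != 0 ->
  (forall u, cross u (q1, q2, q3) = 0 -> exists x, u = scale3 x (q1, q2, q3)) ->
  let A := iota a3 * P3 + iota a2 * P2 + iota a1 * P1 in
  let D := iota b3 * P3 + iota b2 * P2 + iota b1 * P1 in
  [/\ in_ideal3 Q1 Q2 Q3 (w * A) /\ in_ideal3 Q1 Q2 Q3 (w * D),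
      (forall f, in_ideal3 Q1 Q2 Q3 (w * f) -> exists x y,
         in_ideal3 Q1 Q2 Q3 (f - (iota x * A + iota y * D))) &
      (forall x y, in_ideal3 Q1 Q2 Q3 (iota x * A + iota y * D) <->
         exists c1 c2 c3 : S,
           in_ideal3 q1 q2 q3 (x - (c1 * b3 + c2 * b2 + c3 * b1)) /\
           in_ideal3 q1 q2 q3 (y - (c1 * a3 + c2 * a2 + c3 * a1)))].
Proof.
move=> iotaK w0 pi_w pi_split oppr2 [E1 E2 E3] qE exactQ c0 depth A D.
have QE : (Q1, Q2, Q3) = map3 iota (cross (a1, a2, a3) (b1, b2, b3)) +
  scale3 w (P1, P2, P3) by rewrite -qE E1 E2 E3.
have AE : A = dot (map3 iota (a1, a2, a3)) (P1, P2, P3) by exact: addr3_rev.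
have DE : D = dot (map3 iota (b1, b2, b3)) (P1, P2, P3) by exact: addr3_rev.
split=> [|f /in_ideal3P fQ|x y].
- have [HA HD] := generators_annihilated QE.
  by rewrite AE DE; split; apply/in_ideal3P.
- rewrite qE in c0 depth.
  have [x [y H]] :=
    annihilator_generated iotaK w0 pi_w pi_split QE c0 depth fQ.
  by exists x, y; rewrite AE DE; apply/in_ideal3P.
have H : in_ideal3 Q1 Q2 Q3 (iota x * A + iota y * D) <->
    exists e, in_ideal3 q1 q2 q3 (x - dot e (b1, b2, b3)) /\
              in_ideal3 q1 q2 q3 (y - dot e (a1, a2, a3)).
  rewrite AE DE; apply: (iff_trans (in_ideal3P _ _ _ _)).
  rewrite qE in c0; apply: (iff_trans
    (annihilator_relations iotaK pi_w QE exactQ c0 x y)); rewrite -qE.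
  split=> -[e [Hx Hy]]; exists e.
    by rewrite (oppr2 (dot e (a1, a2, a3))); split; apply/in_ideal3P.
  by rewrite (oppr2 (dot e (a1, a2, a3))) in Hy; split; apply/in_ideal3P.
apply: (iff_trans H); split=> [[[[e1 e2] e3] [Hx Hy]]|[e3 [e2 [e1 [Hx Hy]]]]].
  by exists e3, e2, e1; split; rewrite addr3_rev.
by exists (e1, e2, e3); split; rewrite /dot /= addr3_rev.
Qed.

(** * Reductions of polynomials *)

Section MPolyMorphisms.
Context (n : nat) (F S : comNzRingType).
Implicit Types f g : {rmorphism {mpoly F[n]} -> S}.

(** Congruence modulo [d] respects sums and products, so constants and variables decide it; [d = 0]
    gives equality of morphisms. *)
Lemma mpoly_rmorph_eqmod f g d :
  (forall c, f c%:MP = g c%:MP) ->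
  (forall i, exists y, f 'X_i - g 'X_i = d * y) ->
  forall x, exists y, f x - g x = d * y.
Proof.
move=> fgC fgX; pose eqmod a b := exists y, a - b = d * y.
have eqM a b a' b' : eqmod a b -> eqmod a' b' -> eqmod (a * a') (b * b').
  move=> [y E] [y' E']; exists (y * a' + b * y').
  by transitivity ((d * y) * a' + b * (d * y')); [rewrite -E -E'; ring|ring].
have eqD a b a' b' : eqmod a b -> eqmod a' b' -> eqmod (a + a') (b + b').
  by move=> [y E] [y' E']; exists (y + y'); rewrite mulrDr -E -E'; ring.
have eqxx a : eqmod a a by exists 0; rewrite subrr mulr0.
move=> x; rewrite -/(eqmod _ _); elim/mpolyind: x => [|c m x _ _ IH].
  by rewrite !rmorph0.
rewrite !rmorphD -mul_mpolyC !rmorphM fgC; apply: (eqD) => //; apply: (eqM) => //.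
rewrite mpolyXE_id !rmorph_prod /=; apply: (big_ind2 eqmod) => // i _.
rewrite !rmorphXn; elim: (m i) => [|e IHe]; first by rewrite !expr0.
by rewrite !exprS; apply: (eqM) => //; apply: fgX.
Qed.

Lemma mpoly_rmorph_ext f g :
  (forall c, f c%:MP = g c%:MP) -> (forall i, f 'X_i = g 'X_i) -> f =1 g.
Proof.
move=> fgC fgX x; have [|y] := @mpoly_rmorph_eqmod f g 0 fgC _ x.
  by move=> i; exists 0; rewrite fgX subrr mulr0.
by rewrite mul0r => /eqP; rewrite subr_eq0 => /eqP.
Qed.

End MPolyMorphisms.

Lemma addrr_F2 n (x : {mpoly 'F_2[n]}) : x + x = 0.
Proof.
rewrite -mulr2n -scaler_nat (_ : 2%:R = 0) ?scale0r //; exact/eqP.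
Qed.

Lemma oppr_F2 n (x : {mpoly 'F_2[n]}) : - x = x.
Proof. by apply/eqP; rewrite eq_sym -subr_eq0 opprK addrr_F2. Qed.

HB.instance Definition _ := GRing.RMorphism.copy incl (comp_mpoly [tuple w2; w3]).

Definition proj : W1 -> W2 := comp_mpoly [tuple 0; v2; v3].
HB.instance Definition _ := GRing.RMorphism.copy proj (comp_mpoly [tuple 0; v2; v3]).

(** Reduction modulo a variable stays in the same ring, so divisibility by the variable becomes
    vanishing of the reduction. *)
Definition red_v3 : W2 -> W2 := comp_mpoly [tuple v2; 0].
HB.instance Definition _ := GRing.RMorphism.copy red_v3 (comp_mpoly [tuple v2; 0]).
Definition red_w2 : W1 -> W1 := comp_mpoly [tuple w1; 0; w3].
HB.instance Definition _ := GRing.RMorphism.copy red_w2 (comp_mpoly [tuple w1; 0; w3]).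
Definition red_w3 : W1 -> W1 := comp_mpoly [tuple w1; w2; 0].
HB.instance Definition _ := GRing.RMorphism.copy red_w3 (comp_mpoly [tuple w1; w2; 0]).

Lemma ord2_cases (P : 'I_2 -> Prop) :
  P (@Ordinal 2 0 isT) -> P (@Ordinal 2 1 isT) -> forall i, P i.
Proof.
move=> P0 P1 [[|[|//]] lt_i]; [move: P0|move: P1];
  by congr P; apply: val_inj.
Qed.

Lemma ord3_cases (P : 'I_3 -> Prop) :
  P (@Ordinal 3 0 isT) -> P (@Ordinal 3 1 isT) -> P (@Ordinal 3 2 isT) ->
  forall i, P i.
Proof.
move=> P0 P1 P2 [[|[|[|//]]] lt_i]; [move: P0|move: P1|move: P2];
  by congr P; apply: val_inj.
Qed.

Lemma incl_v2 : incl v2 = w2. Proof. exact: comp_mpolyXU. Qed.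
Lemma incl_v3 : incl v3 = w3. Proof. exact: comp_mpolyXU. Qed.
Lemma proj_w1 : proj w1 = 0. Proof. exact: comp_mpolyXU. Qed.
Lemma proj_w2 : proj w2 = v2. Proof. exact: comp_mpolyXU. Qed.
Lemma proj_w3 : proj w3 = v3. Proof. exact: comp_mpolyXU. Qed.
Lemma red_v3_v2 : red_v3 v2 = v2. Proof. exact: comp_mpolyXU. Qed.
Lemma red_v3_v3 : red_v3 v3 = 0. Proof. exact: comp_mpolyXU. Qed.
Lemma red_w2_w1 : red_w2 w1 = w1. Proof. exact: comp_mpolyXU. Qed.
Lemma red_w2_w2 : red_w2 w2 = 0. Proof. exact: comp_mpolyXU. Qed.
Lemma red_w3_w1 : red_w3 w1 = w1. Proof. exact: comp_mpolyXU. Qed.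
Lemma red_w3_w2 : red_w3 w2 = w2. Proof. exact: comp_mpolyXU. Qed.
Lemma red_w3_w3 : red_w3 w3 = 0. Proof. exact: comp_mpolyXU. Qed.

Lemma mpolyX_neq0 n (i : 'I_n) : 'X_i != 0 :> {mpoly 'F_2[n]}.
Proof.
by apply/eqP => /(congr1 (mcoeff U_(i))); rewrite mcoeffX eqxx mcoeff0 => /eqP.
Qed.

Lemma inclK : cancel incl proj.
Proof.
apply: (@mpoly_rmorph_ext _ _ _ (proj \o incl) idfun) => [c|] /=.
  by rewrite /incl comp_mpolyC /proj comp_mpolyC.
by apply: ord2_cases; rewrite -?/v2 -?/v3 ?incl_v2 ?incl_v3 ?proj_w2 ?proj_w3.
Qed.

Lemma incl_proj f : exists g, f = incl (proj f) + w1 * g.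
Proof.
suff [g /= E] : exists g, idfun f - (incl \o proj) f = w1 * g.
  by exists g; rewrite -E addrC subrK.
move: f; apply: mpoly_rmorph_eqmod => [c|] /=.
  by rewrite /proj comp_mpolyC /incl comp_mpolyC.
apply: ord3_cases; rewrite -?/w1 -?/w2 -?/w3 ?proj_w1 ?proj_w2 ?proj_w3
  ?incl_v2 ?incl_v3 ?rmorph0.
- by exists 1; rewrite subr0 mulr1.
- by exists 0; rewrite subrr mulr0.
- by exists 0; rewrite subrr mulr0.
Qed.

Lemma comp_mpoly_mod n (t : n.-tuple {mpoly 'F_2[n]}) d :
  (forall i, exists y, 'X_i - ('X_i \mPo t) = d * y) ->
  forall f, exists g, f = (f \mPo t) + d * g.
Proof.
move=> Xt f; suff [g E] : exists g, f - (f \mPo t) = d * g.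
  by exists g; rewrite -E [RHS]addrC subrK.
apply: (@mpoly_rmorph_eqmod _ _ _ idfun (comp_mpoly t)) => //= c.
by rewrite comp_mpolyC.
Qed.

Lemma red_v3_mod f : exists g, f = red_v3 f + v3 * g.
Proof.
apply: comp_mpoly_mod; apply: ord2_cases; rewrite comp_mpolyXU.
- by exists 0; rewrite subrr mulr0.
- by exists 1; rewrite subr0 mulr1.
Qed.

Lemma red_w2_mod f : exists g, f = red_w2 f + w2 * g.
Proof.
apply: comp_mpoly_mod; apply: ord3_cases; rewrite comp_mpolyXU.
- by exists 0; rewrite subrr mulr0.
- by exists 1; rewrite subr0 mulr1.
- by exists 0; rewrite subrr mulr0.
Qed.

Lemma red_w3_mod f : exists g, f = red_w3 f + w3 * g.
Proof.
apply: comp_mpoly_mod; apply: ord3_cases; rewrite comp_mpolyXU.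
- by exists 0; rewrite subrr mulr0.
- by exists 0; rewrite subrr mulr0.
- by exists 1; rewrite subr0 mulr1.
Qed.

(** * Koszul exactness of the variables *)

Lemma koszul_exact_regular (R : idomainType) (a b c : R) : c != 0 ->
  (forall x k, x * b = k * c -> exists l, x = l * c) ->
  (forall x k l, x * a = k * b + l * c -> exists k' l', x = k' * b + l' * c) ->
  koszul_exact (a, b, c).
Proof.
move=> c0 regb rega [[x y] z]; rewrite /dot /= => E.
(* Along the regular sequence [c, b, a]: first x = k b + x' c, then k a + y = l c, and finally [c]
   cancels. *)
have [|k [x' Ex]] := rega x (- y) (- z).
  by transitivity (x * a + y * b + z * c - y * b - z * c); [ring|
    rewrite E; ring].
have [|l El] := regb (k * a + y) (- (x' * a + z)).
  transitivity (x * a + y * b + z * c - (x' * a + z) * c); last by rewrite E; ring.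
  by rewrite Ex; ring.
have Ez : l * b + x' * a + z = 0.
  apply: (mulIf c0); rewrite mul0r -E Ex.
  transitivity ((l * c) * b + (x' * a + z) * c); first by ring.
  by rewrite -El; ring.
exists (- l, x', - k); rewrite /cross /=; congr (_, _, _).
- by rewrite Ex; ring.
- by transitivity (k * a + y - k * a); [ring|
    rewrite El; ring].
- by transitivity (l * b + x' * a + z - (l * b + x' * a)); [ring|
    rewrite Ez; ring].
Qed.

(** [f] sets [c] to 0 and [g] sets [b] to 0; after these reductions regularity is cancellation of
    [b] and [a] in the domain. *)
Lemma koszul_exact_reductions (R : idomainType) (f g : {rmorphism R -> R})
    (a b c : R) :
  [/\ a != 0, b != 0 & c != 0] ->
  [/\ f a = a, f b = b & f c = 0] -> g a = a /\ g b = 0 ->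
  (forall x, exists y, x = f x + c * y) ->
  (forall x, exists y, x = g x + b * y) ->
  koszul_exact (a, b, c).
Proof.
move=> [a0 b0 c0] [fa fb fc] [ga gb] modc modb.
apply: koszul_exact_regular => // [x k E|x k l E].
  have [y ->] := modc x; exists y.
  suff -> : f x = 0 by rewrite add0r mulrC.
  by apply: (mulIf b0); rewrite -{1}fb -rmorphM E rmorphM fc mulr0 mul0r.
have [y ->] := modc x; have [z ->] := modb (f x); exists z, y.
suff -> : g (f x) = 0 by rewrite add0r mulrC [c * y]mulrC.
apply: (mulIf a0); rewrite mul0r -{1}ga -rmorphM -{1}fa -rmorphM E.
by rewrite rmorphD !rmorphM fc fb mulr0 addr0 rmorphM gb mulr0.
Qed.

Lemma koszul_exact_vars : koszul_exact (w1, w2, w3).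
Proof.
apply: (@koszul_exact_reductions _ red_w3 red_w2).
- by split; apply: mpolyX_neq0.
- by split; [exact: red_w3_w1|exact: red_w3_w2|exact: red_w3_w3].
- by split; [exact: red_w2_w1|exact: red_w2_w2].
- exact: red_w3_mod.
- exact: red_w2_mod.
Qed.

(** * Recurrent sequences *)

Section LinearRecurrence.
Context (R : comNzRingType) (a b c : R).
Local Notation s := (seq3 a b c).

Lemma seq3S m :
  s m.+1 = a * s m + b * (rec3 a b c m).1.2 + c * (rec3 a b c m).2.
Proof. by rewrite /seq3 /=; case: (rec3 a b c m) => [[x y] z]. Qed.

Lemma seq3SS m : s m.+2 = a * s m.+1 + b * s m + c * (rec3 a b c m).1.2.
Proof. by rewrite /seq3 /=; case: (rec3 a b c m) => [[x y] z]. Qed.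

Lemma seq3SSS m : s m.+3 = a * s m.+2 + b * s m.+1 + c * s m.
Proof. by rewrite /seq3 /=; case: (rec3 a b c m) => [[x y] z]. Qed.

Lemma seq3_0 : s 0 = 1. Proof. by []. Qed.

Lemma seq3_1 : s 1 = a. Proof. by rewrite /seq3 /=; ring. Qed.

Lemma seq3_2 : s 2 = a ^+ 2 + b. Proof. by rewrite /seq3 /=; ring. Qed.

(** Solved backwards, the recurrence puts [c * s m] in the ideal of the next three terms, so each
    shift costs one factor [c]. *)
Lemma seq3_pow_c m : exists k, dot k (s m, s m.+1, s m.+2) = c ^+ m.
Proof.
elim: m => [|m [[[k1 k2] k3] IH]].
  by exists (1, 0, 0); rewrite /dot /= expr0 seq3_0; ring.
exists (c * k2 - k1 * b, c * k3 - k1 * a, k1).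
by rewrite exprS -IH /dot /= seq3SSS; ring.
Qed.

Hypothesis exact_abc : koszul_exact (a, b, c).

(** Modulo [(b, c)] the recurrence reads s_{m+1} = a s_m. The rotations put the changing entry
    last. *)
Lemma koszul_exact_seq3_b m : koszul_exact (s m, b, c).
Proof.
apply/koszul_exact_rot/koszul_exact_rot.
elim: m => [|m IH]; first exact/koszul_exact_rot/koszul_exact1.
have -> : s m.+1 = s m * a + (rec3 a b c m).1.2 * b + (rec3 a b c m).2 * c.
  by rewrite seq3S; ring.
apply: koszul_exact_add; apply: koszul_exact_mul => //.
exact: koszul_exact_rot.
Qed.

(** Modulo [(s m.+1, c)] the recurrence reads s_{m+2} = b s_m. *)
Lemma koszul_exact_seq3_c m : koszul_exact (s m, s m.+1, c).
Proof.
elim: m => [|m IH]; first exact: koszul_exact1.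
apply: koszul_exact_rot.
have -> : s m.+2 = s m * b + (rec3 a b c m).1.2 * c + a * s m.+1.
  by rewrite seq3SS; ring.
apply: koszul_exact_add; apply: koszul_exact_mul.
  by apply: koszul_exact_swap; apply: koszul_exact_rot.
by apply: koszul_exact_rot; apply: koszul_exact_rot; apply: koszul_exact_seq3_b.
Qed.

Lemma koszul_exact_seq3 m : koszul_exact (s m, s m.+1, s m.+2).
Proof.
elim: m => [|m IH]; first exact: koszul_exact1.
have -> : s m.+3 = s m * c + b * s m.+1 + a * s m.+2 by rewrite seq3SSS; ring.
apply: koszul_exact_add; apply: koszul_exact_mul; last exact: koszul_exact_seq3_c.
exact: koszul_exact_rot.
Qed.

End LinearRecurrence.

(** * Identities between q and r in characteristic two *)

Section CharacteristicTwo.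
Context (R : comNzRingType) (b c : R).
Hypothesis addrr : forall x : R, x + x = 0.
Local Notation q := (seq3 0 b c).
Local Notation r := (seq3 b 0 (c ^+ 2)).

(** Supplying the doubled term turns an identity of characteristic two into one that [ring] proves
    over any commutative ring. *)
Let eq_mod2 z (x y : R) : x = y + (z + z) -> x = y.
Proof. by rewrite addrr addr0. Qed.

Let qS m : q m.+3 = b * q m.+1 + c * q m.
Proof. by rewrite seq3SSS mul0r add0r. Qed.

Let rS m : r m.+3 = b * r m.+2 + c ^+ 2 * r m.
Proof. by rewrite seq3SSS mul0r addr0. Qed.

Let q1 : q 1 = 0. Proof. exact: seq3_1. Qed.
Let q2 : q 2 = b. Proof. by rewrite seq3_2 expr0n add0r. Qed.

(* Squaring the characteristic equation X^3 = b X + c of the recurrence. *)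
Lemma q_frobenius m : q (m + 6) = b ^+ 2 * q (m + 2) + c ^+ 2 * q m.
Proof.
rewrite !addnS addn0 !qS; apply: (@eq_mod2 (b * c * q m.+1)); ring.
Qed.

(** Both sides satisfy x_{k+3} = b^2 x_{k+1} + c^2 x_k: the left by [q_frobenius], the right by
    squaring the recurrence. Three initial values suffice. *)
Lemma q_odd k : q (2 * k + 3) = c * q k ^+ 2.
Proof.
suff [] : [/\ q (2 * k + 3) = c * q k ^+ 2, q (2 * k.+1 + 3) = c * q k.+1 ^+ 2 &
  q (2 * k.+2 + 3) = c * q k.+2 ^+ 2] by [].
elim: k => [|k [E0 E1 E2]].
  rewrite !qS q1 q2 seq3_0; split; try ring.
    by apply: (@eq_mod2 (b * c)); ring.
  by apply: (@eq_mod2 (b ^+ 2 * c)); ring.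
split=> //; rewrite (_ : 2 * k.+3 + 3 = 2 * k + 3 + 6)%N; last by lia.
rewrite q_frobenius (_ : 2 * k + 3 + 2 = 2 * k.+1 + 3)%N; last by lia.
rewrite E0 E1 qS; apply/esym/(@eq_mod2 (b * c ^+ 2 * q k * q k.+1)); ring.
Qed.

(** As 2^(s+1) - 3 = 2 (2^s - 3) + 3, [q_odd] propagates the zero q_1. *)
Lemma q_pow2_sub3 s : (1 < s)%N -> q (2 ^ s - 3) = 0.
Proof.
case: s => [|[|s]] // _; elim: s => [|s IH]; first exact: q1.
have s4 : (4 <= 2 ^ s.+2)%N by rewrite !expnS; have := expn_gt0 2 s; lia.
rewrite (_ : 2 ^ s.+3 - 3 = 2 * (2 ^ s.+2 - 3) + 3)%N ?q_odd ?IH ?expr0n ?mulr0 //.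
by rewrite [(2 ^ s.+3)%N]expnS; lia.
Qed.

(* The entries of the cross product of the two syzygies defining A_n and D_n,
   with k = j - 2, l = i - 1 and n = l + 2 k + 6. *)
Lemma q_minors k l : q (k + l + 2) = 0 ->
  [/\ q (l + 2 * k + 4) = c * r k * q l.+1 + r k.+1 * q l.+2,
      q (l + 2 * k + 5) = c * r k.+1 * q l + r k.+2 * q l.+1 &
      q (l + 2 * k + 6) = r k.+2 * q l.+2 + c ^+ 2 * r k * q l].
Proof.
elim: k l => [|k IH] l q0.
  have {}q0 : q l.+2 = 0 by rewrite (_ : l.+2 = 0 + l + 2)%N //; lia.
  rewrite muln0 addn0 !addnS addn0 !qS q0 seq3_0 seq3_1 seq3_2; split; try ring.
  by apply: (@eq_mod2 (b * c * q l.+1)); ring.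
(* Trading [(k.+1, l)] for [(k, l.+1)] preserves the sum, hence the vanishing hypothesis. *)
have [|E1 E2 E3] := IH l.+1; first by rewrite (_ : k + l.+1 + 2 = k.+1 + l + 2)%N //; lia.
rewrite (_ : l + 2 * k.+1 + 4 = l.+1 + 2 * k + 5)%N; last by lia.
rewrite (_ : l + 2 * k.+1 + 5 = l.+1 + 2 * k + 6)%N; last by lia.
rewrite (_ : l + 2 * k.+1 + 6 = (l.+1 + 2 * k + 4).+3)%N; last by lia.
rewrite (qS (l.+1 + 2 * k + 4)).
rewrite (_ : (l.+1 + 2 * k + 4).+1 = l.+1 + 2 * k + 5)%N; last by lia.
rewrite E1 E2 E3 !qS !rS; split; try ring.
by apply: (@eq_mod2 (b * c * r k.+1 * q l.+1)); ring.
Qed.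

Lemma q_cross k l : q (k + l + 2) = 0 ->
  (q (l + 2 * k + 4), q (l + 2 * k + 5), q (l + 2 * k + 6)) =
  cross (r k.+2, c * r k, r k.+1) (c * q l, q l.+2, q l.+1).
Proof.
case/q_minors => -> -> ->; rewrite /cross /=; congr (_, _, _).
- by apply: (@eq_mod2 (r k.+1 * q l.+2)); ring.
- by apply: (@eq_mod2 (r k.+2 * q l.+1)); ring.
- by apply: (@eq_mod2 (c ^+ 2 * r k * q l)); ring.
Qed.

End CharacteristicTwo.

(** * The sequences p, depth of the q's, and the ungraded presentation of K *)

Lemma seq3_map (R S : comNzRingType) (f : {rmorphism R -> S}) a b c m :
  f (seq3 a b c m) = seq3 (f a) (f b) (f c) m.
Proof. by rewrite /seq3 rec3_map. Qed.

Lemma incl_r m : incl (r m) = seq3 w2 0 (w3 ^+ 2) m.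
Proof. by rewrite [LHS]seq3_map /= incl_v2 rmorph0 rmorphXn /= incl_v3. Qed.

Lemma QpE m : Q m = incl (q m) + w1 * p m.
Proof. by rewrite (p_specP m) addrC subrK. Qed.

(** [p] is chosen by [epsilon], so its values and recurrence are recovered by cancelling [a]. *)
Lemma seq3_quotient (R : idomainType) (a b c : R) (P : nat -> R) : a != 0 ->
  (forall m, a * P m = seq3 a b c m - seq3 0 b c m) ->
  [/\ P 0 = 0, P 1 = 1, P 2 = a &
      forall m, P m.+3 = seq3 a b c m.+2 + b * P m.+1 + c * P m].
Proof.
move=> a0 aP; split=> [|||m]; apply: (mulfI a0); rewrite ?aP.
- by rewrite !seq3_0; ring.
- by rewrite !seq3_1; ring.
- by rewrite !seq3_2; ring.
- transitivity (a * seq3 a b c m.+2 + b * (a * P m.+1) + c * (a * P m)).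
    by rewrite !aP !seq3SSS; ring.
  by ring.
Qed.

Lemma p_quotient : [/\ p 0 = 0, p 1 = 1, p 2 = w1 &
  forall m, p m.+3 = Q m.+2 + w2 * p m.+1 + w3 * p m].
Proof.
apply: seq3_quotient => [|m]; first exact: mpolyX_neq0.
by rewrite (p_specP m) incl_q.
Qed.

(** Modulo [c] the recurrence has step two. This shows that [v3] does not divide [q] at even
    indices. *)
Lemma seq3_even_mod (R : comNzRingType) (b c : R) k :
  exists y, seq3 0 b c (2 * k) = b ^+ k + c * y.
Proof.
elim: k => [|k [y IH]]; first by exists 0; rewrite muln0 seq3_0 mulr0 addr0.
exists (b * y + (rec3 0 b c (2 * k)).1.2).
by rewrite (_ : 2 * k.+1 = (2 * k).+2)%N ?seq3SS ?IH ?exprS; [ring|lia].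
Qed.

Lemma reduction_dvd (R : idomainType) (f : {rmorphism R -> R}) (z a : R) :
  f z = 0 -> (forall x, exists y, x = f x + z * y) -> f a != 0 ->
  forall x, (exists y, x * a = z * y) -> exists y, x = z * y.
Proof.
move=> fz modz fa x [y E]; have [g xE] := modz x; exists g.
suff fx0 : f x = 0 by rewrite fx0 add0r in xE.
by apply: (mulIf fa); rewrite -rmorphM E rmorphM fz !mul0r.
Qed.

Lemma red_v3_q_even k : red_v3 (q (2 * k)) != 0.
Proof.
rewrite /q; have [y ->] := @seq3_even_mod _ v2 v3 k.
rewrite rmorphD rmorphXn rmorphM /= red_v3_v2 red_v3_v3 mul0r addr0.
by rewrite expf_neq0 // mpolyX_neq0.
Qed.

(** One of [m], [m.+1] is even, so [v3] fails to divide one of the first two entries, while a power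
    of [v3] lies in the ideal. *)
Lemma q_depth m (c : W2 * W2 * W2) : dot c (q m, q m.+1, q m.+2) = v3 ^+ m ->
  forall u, cross u (q m, q m.+1, q m.+2) = 0 ->
  exists x, u = scale3 x (q m, q m.+1, q m.+2).
Proof.
move=> cq; apply: (parallel_multiple _ cq) => [|x Ex Ex']; first exact: mpolyX_neq0.
have dvd a : red_v3 a != 0 -> (exists y, x * a = v3 * y) -> exists y, x = v3 * y.
  by move=> a0; apply: (reduction_dvd red_v3_v3 red_v3_mod a0).
have [k /orP [/eqP mE|/eqP mE]] : exists k, (m == 2 * k)%N || (m.+1 == 2 * k)%N.
  exists (uphalf m); have := odd_double_half m; rewrite uphalf_half.
  by case: (odd m) => /=; lia.
- by apply: dvd Ex; rewrite mE red_v3_q_even.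
- by apply: dvd Ex'; rewrite /= mE red_v3_q_even.
Qed.

Lemma q_syzygies_cross k l s : (k + l + 5 = 2 ^ s)%N ->
  (q (l + 2 * k + 4), q (l + 2 * k + 5), q (l + 2 * k + 6)) =
  cross (r k.+2, v3 * r k, r k.+1) (v3 * q l, q l.+2, q l.+1).
Proof.
move=> skl; apply: q_cross; first exact: addrr_F2.
(* With [k = j - 2], [l = i - 1] and [s = t - 1], this is i + j = 2^s - 2. *)
rewrite (_ : k + l + 2 = 2 ^ s - 3)%N; last by lia.
by apply: q_pow2_sub3; [exact: addrr_F2|case: s skl => [|[|s]] //=; lia].
Qed.

Lemma incl_v3M x : incl (v3 * x) = w3 * incl x.
Proof. by rewrite rmorphM /= incl_v3. Qed.

Lemma koszul_exact_Q m : koszul_exact (Q m, Q m.+1, Q m.+2).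
Proof. exact: koszul_exact_seq3 koszul_exact_vars m. Qed.

Lemma kernel_presentation k l s n :
  (k + l + 5 = 2 ^ s)%N -> (n = l + 2 * k + 6)%N ->
  let A := incl (r k.+1) * p n + incl (v3 * r k) * p (n - 1) +
           incl (r k.+2) * p (n - 2) in
  let D := incl (q l.+1) * p n + incl (q l.+2) * p (n - 1) +
           incl (v3 * q l) * p (n - 2) in
  [/\ inI n (w1 * A) /\ inI n (w1 * D),
      (forall f, inI n (w1 * f) ->
         exists x y : W2, inI n (f - (incl x * A + incl y * D))) &
      (forall x y, inI n (incl x * A + incl y * D) <->
         exists c1 c2 c3 : W2,
           inJ n (x - (c1 * q l.+1 + c2 * q l.+2 + c3 * (v3 * q l))) /\
           inJ n (y - (c1 * r k.+1 + c2 * (v3 * r k) + c3 * r k.+2)))].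
Proof.
move=> skl nE; have := q_syzygies_cross skl.
have [m [n0 n1 n2]] : exists m, [/\ n = m.+2, (n - 1 = m.+1)%N & (n - 2 = m)%N].
  by exists (n - 2)%N; split; lia.
rewrite (_ : l + 2 * k + 4 = m)%N; last by lia.
rewrite (_ : l + 2 * k + 5 = m.+1)%N; last by lia.
rewrite (_ : l + 2 * k + 6 = m.+2)%N; last by lia.
rewrite /inI /inJ n1 n2 n0 => qE.
(* The same [c] serves twice: for the nonzero determinant and for the depth condition. *)
have [c cE] : exists c, dot c (q m, q m.+1, q m.+2) = v3 ^+ m by exact: seq3_pow_c.
apply: (annihilator_presentation (c := c) inclK (mpolyX_neq0 _) proj_w1 incl_proj
  (@oppr_F2 2) _ qE).
- by split; apply: QpE.
- exact: koszul_exact_Q.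
- by rewrite cE expf_neq0 // mpolyX_neq0.
- exact: q_depth cE.
Qed.

(** * Gradings *)

Section Grading.
Context (R : comNzRingType) (H : nat -> R -> Prop).
Hypothesis H1 : H 0 1.
Hypothesis HD : forall d x y, H d x -> H d y -> H d (x + y).
Hypothesis HM : forall d e x y, H d x -> H e y -> H (d + e) (x * y).

(** The abstract [H] covers [homog1] and [homog2]. The unit [g] is 1 for [Q] and [q], and 2 for [r],
    whose nonzero coefficients have degrees 2 and 6. *)
Lemma graded_seq3 g a b c m : H g a -> H (g * 2) b -> H (g * 3) c ->
  H (g * m) (seq3 a b c m).
Proof.
move=> Ha Hb Hc.
have HM' d e f x y : H d x -> H e y -> (d + e = f)%N -> H f (x * y).
  by move=> Hx Hy <-; apply: HM.
suff [] : [/\ H (g * m) (seq3 a b c m), H (g * m.+1) (seq3 a b c m.+1) &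
              H (g * m.+2) (seq3 a b c m.+2)] by [].
elim: m => [|m [IH0 IH1 IH2]].
  rewrite seq3_0 seq3_1 seq3_2 muln0 muln1; split=> //.
  by apply: HD => //; apply: (HM' _ _ _ _ _ Ha Ha); lia.
split=> //; rewrite seq3SSS; apply: HD; first apply: HD.
- by apply: (HM' _ _ _ _ _ Ha IH2); lia.
- by apply: (HM' _ _ _ _ _ Hb IH1); lia.
- by apply: (HM' _ _ _ _ _ Hc IH0); lia.
Qed.

End Grading.

Lemma homog1_0 d : homog1 d 0. Proof. exact: dhomog0. Qed.
Lemma homog1_1 : homog1 0 1. Proof. exact: dhomog1. Qed.
Lemma homog1D d x y : homog1 d x -> homog1 d y -> homog1 d (x + y).
Proof. exact: dhomogD. Qed.
Lemma homog1M d e x y : homog1 d x -> homog1 e y -> homog1 (d + e) (x * y).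
Proof. exact: dhomogM. Qed.
Lemma homog1X (i : 'I_3) : homog1 i.+1 'X_i.
Proof. by rewrite /homog1 dhomogX; apply/eqP/mnmwgt1. Qed.
Lemma homog1_w1 : homog1 1 w1. Proof. exact: homog1X. Qed.
Lemma homog1_w2 : homog1 2 w2. Proof. exact: homog1X. Qed.
Lemma homog1_w3 : homog1 3 w3. Proof. exact: homog1X. Qed.

Lemma homog1_seq3 g a b c m : homog1 g a -> homog1 (g * 2) b -> homog1 (g * 3) c ->
  homog1 (g * m) (seq3 a b c m).
Proof.
apply: (@graded_seq3 _ (fun d x => homog1 d x)).
- exact: homog1_1.
- exact: homog1D.
- exact: homog1M.
Qed.

Lemma homog1_Q m : homog1 m (Q m).
Proof.
rewrite -[X in homog1 X]mul1n; apply: homog1_seq3.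
- exact: homog1_w1.
- exact: homog1_w2.
- exact: homog1_w3.
Qed.

Lemma homog1_incl_q m : homog1 m (incl (q m)).
Proof.
rewrite incl_q -[X in homog1 X]mul1n; apply: homog1_seq3.
- exact: homog1_0.
- exact: homog1_w2.
- exact: homog1_w3.
Qed.

Lemma homog1_incl_r m : homog1 (2 * m) (incl (r m)).
Proof.
rewrite incl_r; apply: homog1_seq3.
- exact: homog1_w2.
- exact: homog1_0.
- by rewrite expr2; apply: (@homog1M 3 3); exact: homog1_w3.
Qed.

(** The shifted index avoids a truncated m - 1; the induction carries three consecutive terms of the
    recurrence. *)
Lemma homog1_p m : homog1 m (p m.+1).
Proof.
have [p0 p1 p2 p_rec] := p_quotient.
suff [IH _ _] : [/\ homog1 m (p m.+1), homog1 m.+1 (p m.+2) &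
  homog1 m.+2 (p m.+3)] by exact: IH.
elim: m => [|m [IH0 IH1 IH2]].
  rewrite p_rec p1 p2 p0; split; [exact: homog1_1|exact: homog1_w1|].
  apply: homog1D; last by rewrite mulr0; exact: homog1_0.
  apply: homog1D; first exact: homog1_Q.
  by rewrite mulr1; exact: homog1_w2.
split; [exact: IH1|exact: IH2|].
rewrite p_rec; apply: homog1D; first apply: homog1D.
- exact: homog1_Q.
- exact: (homog1M homog1_w2 IH1).
- exact: (homog1M homog1_w3 IH0).
Qed.

Lemma wgt2_0 : wgt2 0%MM = 0%N.
Proof. by rewrite /wgt2 !mnm0E. Qed.
Lemma wgt2D : {morph wgt2 : m1 m2 / (m1 + m2)%MM >-> (m1 + m2)%N}.
Proof. by move=> m1 m2; rewrite /wgt2 !mnmDE; lia. Qed.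
HB.instance Definition _ := isMeasure.Build 2 wgt2 wgt2_0 wgt2D.

Lemma homog2E d x : homog2 d x = (x \is ishomog1 d wgt2).
Proof. by []. Qed.

Lemma homog2_0 d : homog2 d 0. Proof. by rewrite homog2E; exact: dhomog0. Qed.
Lemma homog2_1 : homog2 0 1. Proof. by rewrite homog2E; exact: dhomog1. Qed.
Lemma homog2D d x y : homog2 d x -> homog2 d y -> homog2 d (x + y).
Proof. rewrite !homog2E; exact: dhomogD. Qed.
Lemma homog2M d e x y : homog2 d x -> homog2 e y -> homog2 (d + e) (x * y).
Proof. rewrite !homog2E; exact: dhomogM. Qed.
Lemma homog2_v2 : homog2 2 v2.
Proof. by rewrite homog2E dhomogX /= /wgt2 !mnm1E. Qed.
Lemma homog2_v3 : homog2 3 v3.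
Proof. by rewrite homog2E dhomogX /= /wgt2 !mnm1E. Qed.

Lemma homog2_seq3 g a b c m : homog2 g a -> homog2 (g * 2) b -> homog2 (g * 3) c ->
  homog2 (g * m) (seq3 a b c m).
Proof.
apply: (@graded_seq3 _ (fun d x => homog2 d x)).
- exact: homog2_1.
- exact: homog2D.
- exact: homog2M.
Qed.

Lemma homog2_q m : homog2 m (q m).
Proof.
rewrite -[X in homog2 X]mul1n; apply: homog2_seq3.
- exact: homog2_0.
- exact: homog2_v2.
- exact: homog2_v3.
Qed.

Lemma homog2_r m : homog2 (2 * m) (r m).
Proof.
apply: homog2_seq3.
- exact: homog2_v2.
- exact: homog2_0.
- by rewrite expr2; apply: (@homog2M 3 3); exact: homog2_v3.
Qed.

(** The substitution [k = j - 2], [l = i - 1] removes all truncated subtractions; the bounds on [n]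
    say exactly that both are natural numbers. *)
Lemma idx_shift t n : (2 ^ t.-1 < n)%N -> (n <= 2 ^ t - 4)%N ->
  exists k l, [/\ (k + l + 5 = 2 ^ t.-1)%N, (n = l + 2 * k + 6)%N,
    idx_i t n = l.+1, idx_j t n = k.+2 & (2 ^ t = 2 * (k + l + 5))%N].
Proof.
case: t => [|t] /=; first by rewrite expn0; lia.
rewrite /idx_i /idx_j /= expnS => lo hi.
by exists (n - 2 ^ t - 1)%N, (2 * 2 ^ t - 4 - n)%N; split; lia.
Qed.

(** [l + 4 * k + 7] is 3n - 2^t - 1 after the substitution. *)
Lemma An_homog k l n : (n = l + 2 * k + 6)%N ->
  homog1 (l + 4 * k + 7) (incl (r k.+1) * p n + w3 * incl (r k) * p (n - 1) +
                          incl (r k.+2) * p (n - 2)).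
Proof.
have HM d e f x y : homog1 d x -> homog1 e y -> (d + e = f)%N -> homog1 f (x * y).
  by move=> Hx Hy <-; apply: homog1M.
move=> nE; have [m [-> -> -> mE]] : exists m,
  [/\ n = m.+3, (n - 1 = m.+2)%N, (n - 2 = m.+1)%N & (m = l + 2 * k + 3)%N].
  by exists (n - 3)%N; split; lia.
apply: homog1D; first apply: homog1D.
- by apply: (HM _ _ _ _ _ (homog1_incl_r _) (homog1_p _)); lia.
- by apply: (HM _ _ _ _ _ (homog1M homog1_w3 (homog1_incl_r _)) (homog1_p _)); lia.
- by apply: (HM _ _ _ _ _ (homog1_incl_r _) (homog1_p _)); lia.
Qed.

Lemma Dn_homog k l n : (n = l + 2 * k + 6)%N ->
  homog1 (2 * k + 2 * l + 6) (incl (q l.+1) * p n + incl (q l.+2) * p (n - 1) +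
                          w3 * incl (q l) * p (n - 2)).
Proof.
have HM d e f x y : homog1 d x -> homog1 e y -> (d + e = f)%N -> homog1 f (x * y).
  by move=> Hx Hy <-; apply: homog1M.
move=> nE; have [m [-> -> -> mE]] : exists m,
  [/\ n = m.+3, (n - 1 = m.+2)%N, (n - 2 = m.+1)%N & (m = l + 2 * k + 3)%N].
  by exists (n - 3)%N; split; lia.
apply: homog1D; first apply: homog1D.
- by apply: (HM _ _ _ _ _ (homog1_incl_q _) (homog1_p _)); lia.
- by apply: (HM _ _ _ _ _ (homog1_incl_q _) (homog1_p _)); lia.
- by apply: (HM _ _ _ _ _ (homog1M homog1_w3 (homog1_incl_q _)) (homog1_p _)); lia.
Qed.

Lemma homogAD_sum dA dD e x y a d : homog2 a x -> homog2 d y ->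
  (dA + a = e)%N -> (dD + d = e)%N -> homogAD dA dD e x y.
Proof.
move=> Hx Hy <- eD; rewrite /homogAD leq_addr addKn -eD.
by apply/andP; split; rewrite ?leq_addr ?addKn.
Qed.

(* H = W_1 / I with I = (Q_{n-2}, Q_{n-1}, Q_n);  C = W_2 / J with
   J = (q_{n-2}, q_{n-1}, q_n);  K = ker (w1 .) on H, a C-module via W_2 -> W_1.
   The C-module map C<A,D> -> K, A |-> A_n, D |-> D_n, is
   (a, d) |-> incl a * A_n + incl d * D_n  (mod I). *)
Theorem mainTheorem18 (t n : nat)
    (hlo : (2 ^ t.-1 < n)%N) (hhi : (n <= 2 ^ t - 4)%N) :
  let i := idx_i t n in
  let j := idx_j t n in
  let A := An t n in
  let D := Dn t n in
  let dA := (3 * n - 2 ^ t - 1)%N in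
  let dD := (2 ^ t - 4)%N in
  [/\ (* A_n, D_n lie in K *)
      inI n (w1 * A) /\ inI n (w1 * D),
      (* degrees *)
      homog1 dA A /\ homog1 dD D,
      (* the induced map C<A,D>/(relations) -> K is surjective *)
      (forall f : W1, inI n (w1 * f) ->
         exists a d : W2, inI n (f - (incl a * A + incl d * D))),
      (* ... and its kernel is exactly the submodule generated by the relations *)
      (forall a d : W2,
         inI n (incl a * A + incl d * D) <->
         exists c1 c2 c3 : W2,
           inJ n (a - (c1 * q i + c2 * q (i + 1) + c3 * (v3 * q (i - 1)))) /\
           inJ n (d - (c1 * r (j - 1) + c2 * (v3 * r (j - 2)) + c3 * r j)))
    & (* the relations have degrees 2n-4, 2n-3, 2n-2 *)
      [/\ homogAD dA dD (2 * n - 4) (q i) (r (j - 1)),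
          homogAD dA dD (2 * n - 3) (q (i + 1)) (v3 * r (j - 2))
        & homogAD dA dD (2 * n - 2) (v3 * q (i - 1)) (r j)]].
Proof.
move=> i j A D dA dD.
have [k [l [skl nE iE jE tE]]] := idx_shift hlo hhi.
have AE : A = incl (r k.+1) * p n + w3 * incl (r k) * p (n - 1) +
              incl (r k.+2) * p (n - 2).
  by rewrite /A /An jE !subSS !subn0.
have DE : D = incl (q l.+1) * p n + incl (q l.+2) * p (n - 1) +
              w3 * incl (q l) * p (n - 2).
  by rewrite /D /Dn iE subSS subn0 addn1.
have dAE : dA = (l + 4 * k + 7)%N by rewrite /dA tE nE; lia.
have dDE : dD = (2 * k + 2 * l + 6)%N by rewrite /dD tE; lia.
have [inK gen rel] := kernel_presentation skl nE.
rewrite (incl_v3M (r k)) (incl_v3M (q l)) -AE -DE in inK gen rel.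
rewrite /i /j iE jE !subSS !subn0 addn1; split.
- exact: inK.
- by rewrite dAE dDE AE DE; split; [apply: An_homog|apply: Dn_homog].
- exact: gen.
- exact: rel.
- have Hq := homog2_q; have Hr := homog2_r; split.
  + by apply: (homogAD_sum (Hq _) (Hr _)); lia.
  + by apply: (homogAD_sum (Hq _) (homog2M homog2_v3 (Hr _))); lia.
  + by apply: (homogAD_sum (homog2M homog2_v3 (Hq _)) (Hr _)); lia.
Qed.
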